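(* If the differentiation operator $D$ is bounded on a discrete function space $\mathcal{X}$ on a tree $T$, then $\sigma(D)$ is a closed subset of \[\{\lambda\in\mathbb{C}:|\lambda|\leq\|D\|\}\cap\{\lambda\in\mathbb{C}:|\lambda-1|\leq\|C_b\|\}.\]
   Context: A tree $T$ is a locally finite, connected, simply-connected graph, identified with its set of vertices. A vertex is terminal if it has a unique neighbor; all trees are assumed to be without terminal vertices (hence infinite) and rooted at a vertex $o$. For $v\neq o$, $v^-$ denotes the unique neighbor of $v$ lying on the path from $o$ to $v$ (the parent of $v$). A function on $T$ is a complex-valued function on its vertices. The backward shift map $b:T\to T$ is $b(v)=v^-$ for $v\neq o$ and $b(o)=o$. The derivative of $f:T\to\mathbb{C}$ is $f'(v)=f(v)-f(b(v))$ for all $v\in T$ (so $f'(o)=0$). A functional Banach space on a set $\Omega$ is a Banach space of complex-valued functions on $\Omega$ with pointwise vector operations, such that $f(x)=g(x)$ for all $x\in\Omega$ implies $f=g$, $f(x)=f(y)$ for every $f$ in the space implies $x=y$, and for each $x\in\Omega$ the linear functional $f\mapsto f(x)$ is continuous. A discrete function space $\mathcal{X}$ on $T$ is a functional Banach space whose elements are functions on $T$, with norm $\|\cdot\|_{\mathcal{X}}$. The differentiation operator is $Df=f'$, and the composition operator induced by $b$ is $C_bf=f\circ b$. An operator is bounded on $\mathcal{X}$ if it is a bounded linear operator from $\mathcal{X}$ to $\mathcal{X}$ ($D$ is bounded on $\mathcal{X}$ if and only if $C_b$ is); $\|D\|$ and $\|C_b\|$ are operator norms on $\mathcal{X}$,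 and $\sigma(D)$ is the spectrum of $D$ on $\mathcal{X}$. *)

(* Defs.v *)
From mathcomp Require Import all_boot all_order all_algebra.
From mathcomp Require Import all_classical all_reals all_analysis.
From mathcomp Require Export complex.

Set Implicit Arguments.
Unset Strict Implicit.
Unset Printing Implicit Defensive.

Import Order.TTheory GRing.Theory Num.Theory.
Import numFieldNormedType.Exports.

Local Open Scope classical_set_scope.
Local Open Scope ring_scope.
Local Open Scope complex_scope.

(* Going through [numFieldType] gives [R[i]] its norm topology. *)
Definition Cplx (R : realType) : numFieldType := R[i].

Record rooted_tree := RootedTree {
  vertex :> choiceType;
  adj : rel vertex;
  origin : vertex;
  adj_sym : forall u v, adj u v = adj v u;
  adj_irr : forall v, ~~ adj v v;
  tree_locally_finite : forall v, finite_set [set w | adj v w];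
  tree_connected : forall u v, exists2 p, path adj u p & last u p = v;
  tree_simply_connected : forall c : seq vertex,
    (2 < size c)%N -> ~ ucycle adj c;
  tree_no_terminal : forall v, ~ (exists! w, adj v w);
  (* rules out the one-vertex graph, where no vertex has a neighbor *)
  tree_infinite : infinite_set [set: vertex] }.

Section Tree.
Variable T : rooted_tree.

(* [w] lies on the path from [u] to [v]. *)
Definition on_path (u v w : T) : Prop :=
  exists p, [/\ path (@adj T) u p, last u p = v, uniq (u :: p) & w \in u :: p].

Definition parent (v : T) : T :=
  xget (origin T) [set w | adj v w /\ on_path (origin T) v w].

Definition backward_shift (v : T) : T :=
  if v == origin T then origin T else parent v.

Variable R : realType.

Definition diff_op (f : T -> Cplx R) : T -> Cplx R :=
  fun v => f v - f (backward_shift v).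

Definition comp_op (phi : T -> T) (f : T -> Cplx R) : T -> Cplx R := f \o phi.

End Tree.

(* The functions on [Omega] in the space are the [eval f]; by [eval_inj] an
   element of the Banach space [fbs_space] is determined by its function. *)
Record functional_banach_space (R : realType) (Omega : Type) := FBS {
  fbs_space :> completeNormedModType (Cplx R);
  eval : fbs_space -> Omega -> Cplx R;
  eval_linear : forall (a : Cplx R) (f g : fbs_space) (x : Omega),
    eval (a *: f + g) x = a * eval f x + eval g x;
  eval_inj : forall f g, (forall x, eval f x = eval g x) -> f = g;
  eval_separates : forall x y, (forall f, eval f x = eval f y) -> x = y;
  eval_continuous : forall x, continuous (fun f => eval f x) }.

Definition discrete_function_space (R : realType) (T : rooted_tree) :=
  functional_banach_space R T.

Section Operators.
Variables (R : realType) (X : completeNormedModType (Cplx R)).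

Definition bounded_operator (A : X -> X) : Prop :=
  linear A /\ bounded_near A (nbhs (0 : X)).

(* Norms are real elements of [R[i]]; the supremum is taken in [R]. *)
Definition opnorm (A : X -> X) : R :=
  sup [set complex.Re (`|A f| : R[i]) | f in [set f : X | `|f| <= 1]].

Definition spectrum (A : X -> X) : set (Cplx R) :=
  [set lambda | ~ exists S : X -> X, [/\ bounded_operator S,
     forall f, S (A f - lambda *: f) = f &
     forall f, A (S f) - lambda *: S f = f]].

End Operators.

Section InducedOperators.
Variables (R : realType) (Omega : Type) (X : functional_banach_space R Omega).
Variable Phi : (Omega -> Cplx R) -> (Omega -> Cplx R).

Definition maps_into : Prop :=
  forall f : X, exists g : X, eval g = Phi (eval f).

(* [Phi] as a self-map of [X]; meaningful when [maps_into] holds. *)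
Definition induced_op (f : X) : X := xget 0 [set g : X | eval g = Phi (eval f)].

Definition bounded_on : Prop := maps_into /\ bounded_operator induced_op.

End InducedOperators.

Arguments maps_into {R Omega} X Phi.
Arguments induced_op {R Omega} X Phi f.
Arguments bounded_on {R Omega} X Phi.
Arguments diff_op T R f v : clear implicits.
Arguments comp_op {T} R phi f v.
Arguments backward_shift {T} v.

(* Main.v *)
Require Import Defs.
From HB Require Import structures.
From mathcomp Require Import all_boot all_order all_algebra.
From mathcomp Require Import all_classical all_reals all_analysis.
Import Order.TTheory GRing.Theory Num.Theory.
Import numFieldNormedType.Exports.
Local Open Scope classical_set_scope.
Local Open Scope ring_scope.
Local Open Scope complex_scope.

(** Everything rests on the Neumann series: if [|A f| <= q |f|] with [q < 1],
    then [1 - A] has the bounded inverse [\sum_k A^k] ([neumann]).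

    Writing [A - lambda] as a product of boundedly invertible operators, one of
    them of the form [1 - B] with [B] small, gives the two general facts about
    the spectrum of a bounded operator [A]:
    - it lies in the disk of radius [opnorm A], since for [|mu| > opnorm A] one
      has [A - mu = - mu (1 - A / mu)] ([boundedly_invertible_gt_opnorm]);
    - it is closed, since if [A - lambda0] has the bounded inverse [S], then
      [A - lambda = (A - lambda0) (1 - (lambda - lambda0) S)] is invertible for
      [lambda] close to [lambda0] ([spectrum_closed]).

    The first fact, applied to [D], gives the disk around [0]. The disk around
    [1] comes from [C_b = 1 - D] ([comp_op_backward_shift]): the operator
    [C_b] is then bounded too, and [D - lambda = - (C_b - (1 - lambda))], so
    that [lambda] is in the spectrum of [D] only if [1 - lambda] is in that of
    [C_b], whence [|1 - lambda| <= opnorm C_b]. *)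

(** * Operators with a bounded inverse *)

Section BoundedOperators.
Variables (R : realType) (X : completeNormedModType (Cplx R)).
Implicit Types (A S U V : X -> X) (f g : X) (q lambda mu : Cplx R).

Lemma ge0_RRe (z : Cplx R) : 0 <= z -> (complex.Re z)%:C = z.
Proof. by move=> z0; apply: RRe_real; exact: ger0_real. Qed.

(** Boundedness and the spectrum are stated for bare functions; this gives
    access to the theory of [{linear X -> X}]. *)
Definition linear_pack {A} (linA : linear A) : {linear X -> X} :=
  HB.pack A (GRing.isLinear.Build (Cplx R) X X *:%R A linA).

Lemma bounded_operatorP A :
  bounded_operator A <->
  linear A /\ exists2 M : Cplx R, 0 < M & forall f, `|A f| <= M * `|f|.
Proof.
split=> -[linA bA]; split=> //.
  by have /(linear_boundedP (linear_pack linA))/pinfty_ex_gt0 := bA.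
case: bA => M M0 AM; apply/(linear_boundedP (linear_pack linA)).
near=> r => f; apply: (le_trans (AM f)); apply: ler_wpM2r => //.
near: r; apply: nbhs_pinfty_ge; exact: gtr0_real.
Unshelve. all: by end_near. Qed.

Definition boundedly_invertible U : Prop :=
  exists S, [/\ bounded_operator S, cancel U S & cancel S U].

(** The lower bound on [U] gives both its injectivity and, read at [f = S g],
    the bound on its inverse [S], which leaves surjectivity as the only point
    where convergence matters. *)
Lemma bounded_below_surj_invertible U (K : Cplx R) :
  linear U -> 0 < K -> (forall f, `|f| <= K * `|U f|) ->
  (forall g, exists f, U f = g) -> boundedly_invertible U.
Proof.
move=> linU K0 below /choice[S US].
have injU f g : U f = U g -> f = g.
  move=> Ufg; apply/eqP; rewrite -subr_eq0 -normr_le0.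
  apply: (le_trans (below _)).
  by rewrite [U _](raddfB (linear_pack linU)) /= Ufg subrr normr0 mulr0.
exists S; split=> //; last by move=> f; apply: injU.
apply/bounded_operatorP; split.
  by move=> a f g; apply: injU; rewrite linU !US.
by exists K => // f; rewrite -{2}(US f).
Qed.

Lemma boundedly_invertible_comp U V :
  boundedly_invertible U -> boundedly_invertible V ->
  boundedly_invertible (U \o V).
Proof.
move=> [S [/bounded_operatorP[linS [K K0 SK]] US SU]].
move=> [W [/bounded_operatorP[linW [L L0 WL]] VW WV]].
exists (W \o S); split; [|exact: can_comp|exact: can_comp].
apply/bounded_operatorP; split.
  by move=> a f g /=; rewrite linS linW.
exists (L * K); first exact: mulr_gt0.
move=> f /=; apply: (le_trans (WL _)).
by rewrite -mulrA; apply: ler_wpM2l (SK f); exact: ltW.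
Qed.

Lemma boundedly_invertible_scale mu :
  mu != 0 -> boundedly_invertible (fun f => mu *: f).
Proof.
move=> mu0; exists (fun f => mu^-1 *: f); split.
- apply/bounded_operatorP; split.
    by move=> a f g; rewrite scalerDr !scalerA mulrC.
  exists `|mu^-1|; first by rewrite normr_gt0 invr_eq0.
  by move=> f; rewrite normrZ.
- by move=> f; rewrite scalerA mulVf// scale1r.
- by move=> f; rewrite scalerA mulfV// scale1r.
Qed.

(** * The Neumann series *)

(** Norms in [X] are elements of [R[i]], whose order is only partial, so the
    comparison is made with a series in [R], through the Cauchy criterion on
    both sides. *)
Lemma dominated_series_cvg (u : X ^nat) (a : R ^nat) :
  (forall k, `|u k| <= (a k)%:C) -> cvgn (series a) -> cvgn (series u).
Proof.
move=> ua /cauchy_cvgP/cauchy_seriesP ca.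
apply/cauchy_cvgP/cauchy_seriesP => e e0.
have eE : (complex.Re e)%:C = e by rewrite ge0_RRe// ltW.
have Re0 : 0 < complex.Re e by rewrite -ltcR eE.
have := ca _ Re0; apply: filterS => n /= lt_e.
apply: (le_lt_trans (ler_norm_sum _ _ _)).
apply: (@le_lt_trans _ _ (\sum_(n.1 <= k < n.2) (a k)%:C)).
  by apply: ler_sum => k _; exact: ua.
rewrite -eE -rmorph_sum ltcR; exact: le_lt_trans (ler_norm _) lt_e.
Qed.

(** The bound [|f| <= |f - A f| + q |f|] makes [1 - A] bounded below by
    [1 - q]. It is onto since [\sum_k A^k g] converges by comparison with a
    geometric series, to a fixed point of [f |-> g + A f]. *)
Lemma neumann A q :
  linear A -> 0 <= q < 1 -> (forall f, `|A f| <= q * `|f|) ->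
  boundedly_invertible (fun f => f - A f).
Proof.
move=> linA /andP[q0 q1] Aq.
pose AL := linear_pack linA.
have linU : linear (fun f => f - A f).
  by move=> a f g; rewrite linA scalerBr opprD addrACA.
apply: (@bounded_below_surj_invertible _ (1 - q)^-1) => //.
- by rewrite invr_gt0 subr_gt0.
- move=> f; rewrite mulrC ler_pdivlMr ?subr_gt0// mulrBr mulr1 lerBlDr.
  rewrite -{1}(subrK (A f) f); apply: (le_trans (ler_normD _ _)).
  by rewrite lerD2l mulrC.
- move=> g; pose u : X ^nat := fun k => iter k A g.
  have u_le k : `|u k| <= (geometric (complex.Re `|g|) (complex.Re q) k)%:C.
    rewrite /= rmorphM rmorphXn /= !ge0_RRe//.
    elim: k => [|k IHk]; first by rewrite expr0 mulr1.
    rewrite [u _]/= (le_trans (Aq _))// exprS mulrCA.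
    exact: ler_wpM2l.
  have cu : cvgn (series u).
    apply: dominated_series_cvg u_le _.
    apply: is_cvg_geometric_series.
    have Req0 : 0 <= complex.Re q by rewrite -lecR ge0_RRe.
    by rewrite ger0_norm// -ltcR ge0_RRe.
  have Acont : continuous A.
    apply: (@bounded_linear_continuous _ _ _ AL).
    apply/(linear_boundedP AL); near=> r => f.
    apply: (le_trans (Aq f)); apply: ler_wpM2r => //.
    near: r; apply: nbhs_pinfty_ge; exact: ger0_real.
  exists (limn (series u)).
  have shift n : series u n.+1 = g + A (series u n).
    rewrite seriesEnat /= big_nat_recl//= [A _](raddf_sum AL).
    by congr (_ + _); apply: eq_bigr.
  have lim_shift : series u n.+1 @[n --> \oo] --> limn (series u).
    by move: cu; rewrite -(cvg_shiftS (series u)).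
  have lim_fix : series u n.+1 @[n --> \oo] --> g + A (limn (series u)).
    under eq_fun do rewrite shift.
    apply: cvgD; first exact: cvg_cst.
    by apply: continuous_cvg => //; exact: Acont.
  by apply/eqP; rewrite subr_eq; apply/eqP; exact: cvg_unique lim_shift lim_fix.
Unshelve. all: by end_near. Qed.

(** * The spectrum of a bounded operator *)

(** The supremum that defines the operator norm is a true one; without this,
    [sup] would have a default value. *)
Lemma opnorm_set_has_sup A : bounded_operator A ->
  has_sup [set complex.Re (`|A f| : R[i]) | f in [set f : X | `|f| <= 1]].
Proof.
move=> /bounded_operatorP[linA [M M0 AM]]; split.
  by exists (complex.Re (`|A 0| : R[i])), 0 => //=; rewrite normr0.
exists (complex.Re M) => _ [f /= f1 <-].
rewrite -lecR !ge0_RRe//; last exact: ltW.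
by rewrite (le_trans (AM f))// ler_piMr// ltW.
Qed.

Lemma opnorm_ge0 A : bounded_operator A -> 0 <= opnorm A.
Proof.
move=> bA; apply: (@le_trans _ _ (complex.Re (`|A 0| : R[i]))).
  by rewrite -lecR ge0_RRe//; exact: normr_ge0.
apply: (sup_upper_bound (opnorm_set_has_sup _ bA)).
by exists 0 => //=; rewrite normr0.
Qed.

Lemma le_opnorm A f : bounded_operator A -> `|A f| <= (opnorm A)%:C * `|f|.
Proof.
move=> bA; have [linA _] := bA.
have [->|f0] := eqVneq f 0.
  by rewrite [A _](raddf0 (linear_pack linA)) !normr0 mulr0.
have nf0 : 0 < `|f| by rewrite normr_gt0.
(* Normalizing [f] turns the quotient into a member of the defining set. *)
rewrite -ler_pdivrMr//.
have -> : `|A f| / `|f| = `|A (`|f|^-1 *: f)|.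
  rewrite [A (_ *: _)](linearZ_LR (linear_pack linA)) normrZ.
  by rewrite normfV normr_id mulrC.
rewrite -[X in X <= _]ge0_RRe// lecR.
apply: (sup_upper_bound (opnorm_set_has_sup _ bA)).
exists (`|f|^-1 *: f) => //=.
by rewrite normrZ normfV normr_id mulVf// gt_eqF.
Qed.

(** [A - mu = - mu (1 - A / mu)], and [A / mu] contracts by the factor
    [opnorm A / |mu| < 1]. *)
Lemma boundedly_invertible_gt_opnorm A mu :
  bounded_operator A -> (opnorm A)%:C < `|mu| ->
  boundedly_invertible (fun f => A f - mu *: f).
Proof.
move=> bA ltmu; have [linA _] := bA.
have opA0 : 0 <= (opnorm A)%:C :> Cplx R by rewrite lecR; exact: opnorm_ge0.
have nmu0 : 0 < `|mu| by exact: le_lt_trans ltmu.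
have mu0 : mu != 0 by rewrite -normr_gt0.
have -> : (fun f => A f - mu *: f) =
    (fun f => - mu *: f) \o (fun f => f - mu^-1 *: A f).
  apply/funext => f /=; rewrite scalerBr scalerA mulNr mulfV// scaleNr scaleN1r.
  by rewrite opprK addrC.
apply: boundedly_invertible_comp.
  by apply: boundedly_invertible_scale; rewrite oppr_eq0.
apply: (@neumann _ ((opnorm A)%:C / `|mu|)).
- by move=> a f g; rewrite linA scalerDr !scalerA mulrC.
- by rewrite divr_ge0//= ltr_pdivrMr// mul1r.
- move=> f; rewrite normrZ normfV mulrC mulrAC.
  by apply: ler_wpM2r; [rewrite invr_ge0|exact: le_opnorm].
Qed.

Lemma spectrumP A lambda :
  spectrum A lambda <-> ~ boundedly_invertible (fun f => A f - lambda *: f).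
Proof. by []. Qed.

(** Around a point [lambda0] of the resolvent set, with [K] a bound for the
    inverse [S] of [A - lambda0], the disk of radius [1 / K] consists of
    resolvent points: there [(lambda - lambda0) S] contracts, and
    [A - lambda = (A - lambda0) (1 - (lambda - lambda0) S)]. *)
Lemma spectrum_closed A : linear A -> closed (spectrum A).
Proof.
move=> linA; rewrite -openC openE => lambda0 /contrapT.
move=> inv0; have [S [/bounded_operatorP[linS [K K0 SK]] _ US]] := inv0.
apply/nbhs_ballP; exists K^-1; first by rewrite /= invr_gt0.
move=> lambda; rewrite -ball_normE /= => lt_lambda /spectrumP; apply.
have -> : (fun f => A f - lambda *: f) =
    (fun f => A f - lambda0 *: f) \o (fun f => f - (lambda - lambda0) *: S f).
  apply/funext => f /=.
  transitivity (A f - lambda0 *: f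
                - (lambda - lambda0) *: (A (S f) - lambda0 *: S f)).
    by have /= -> := US f; rewrite scalerBl opprB addrA subrK.
  rewrite [A (_ - _)](raddfB (linear_pack linA)) /=.
  rewrite [A (_ *: _)](linearZ_LR (linear_pack linA)) /=.
  by rewrite !scalerBr !scalerA (mulrC lambda0) !opprD addrACA.
apply: boundedly_invertible_comp => //.
apply: (@neumann _ (`|lambda0 - lambda| * K)).
- by move=> a f g; rewrite linS scalerDr !scalerA mulrC.
- by rewrite mulr_ge0 ?(ltW K0)//= -ltr_pdivlMr// mul1r.
- by move=> f; rewrite normrZ distrC -mulrA; apply: ler_wpM2l.
Qed.
End BoundedOperators.

(** * Differentiation and composition with the backward shift *)

Section Induced.
Variables (R : realType) (Omega : Type) (X : functional_banach_space R Omega).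
Implicit Types (f g : X) (Phi : (Omega -> Cplx R) -> Omega -> Cplx R).

Lemma eval_induced_op Phi f :
  maps_into X Phi -> Defs.eval (induced_op X Phi f) = Phi (Defs.eval f).
Proof. by move=> XPhi; exact: (xgetPex 0 (XPhi f)). Qed.

Lemma evalB f g x : Defs.eval (f - g) x = Defs.eval f x - Defs.eval g x.
Proof. by rewrite addrC -scaleN1r eval_linear mulN1r addrC. Qed.
End Induced.

(** [f (b v) = f v - f' v]; hence the space, being stable under [D], is stable
    under [C_b] as well, and [induced_op] is meaningful for both. *)
Lemma comp_op_backward_shift (R : realType) (T : rooted_tree)
    (X : discrete_function_space R T) :
  maps_into X (diff_op T R) ->
  induced_op X (comp_op R backward_shift) =
    fun f => f - induced_op X (diff_op T R) f.
Proof.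
move=> XD.
have evalC (f : X) : Defs.eval (f - induced_op X (diff_op T R) f) =
    comp_op R backward_shift (Defs.eval f).
  apply/funext => v; rewrite evalB eval_induced_op// /diff_op /comp_op /=.
  by rewrite opprB addrC subrK.
apply/funext => f; apply: eval_inj => v; rewrite evalC eval_induced_op//.
by move=> {}f; exists (f - induced_op X (diff_op T R) f).
Qed.

Theorem corollary2p15 (R : realType) (T : rooted_tree)
    (X : discrete_function_space R T) :
  bounded_on X (diff_op T R) ->
  closed (spectrum (induced_op X (diff_op T R))) /\
  spectrum (induced_op X (diff_op T R)) `<=`
    [set lambda : Cplx R |
       `|lambda| <= (opnorm (induced_op X (diff_op T R)))%:C] `&`
    [set lambda : Cplx R |
       `|lambda - 1| <=
         (opnorm (induced_op X (comp_op R backward_shift)))%:C].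
Proof.
move=> [XD bD]; have CE := comp_op_backward_shift _ _ _ XD.
set D := induced_op X (diff_op T R) in bD CE *.
have [linD [M M0 DM]] := (bounded_operatorP _ _ _).1 bD.
have real_opnorm (B : X -> X) : (opnorm B)%:C \is @Num.real (Cplx R).
  by rewrite realE !lecR; exact: le_total.
split; first exact: spectrum_closed.
move=> lambda; rewrite spectrumP => specl; split => /=.
  rewrite real_leNgt//; apply/negP => ltl.
  by apply: specl; exact: boundedly_invertible_gt_opnorm.
rewrite {}CE; set C := fun f => f - D f.
have bC : bounded_operator C.
  apply/bounded_operatorP; split.
    by move=> a f g; rewrite /C linD scalerBr opprD addrACA.
  exists (1 + M); first by rewrite addr_gt0.
  move=> f; rewrite mulrDl mul1r; apply: (le_trans (ler_normB _ _)).
  by rewrite lerD2l.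
rewrite real_leNgt//; apply/negP => ltl; apply: specl.
have -> : (fun f => D f - lambda *: f) =
    (fun f => -1 *: f) \o (fun f => C f - (1 - lambda) *: f).
  apply/funext => f /=; rewrite /C scalerBl scale1r scaleN1r.
  by rewrite opprB opprB [RHS]addrC addrA subrK.
apply: boundedly_invertible_comp.
  by apply: boundedly_invertible_scale; rewrite oppr_eq0 oner_eq0.
by apply: boundedly_invertible_gt_opnorm; rewrite // distrC.
Qed.
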